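(* Let $w(y)=\left(1+\sqrt{1-y}\right)^{-1/2}=\sum_{k\ge 0}a_k y^k$ for $0<y<1$. For $x>0$ let $\xi$ be the random variable having the power series distribution of $w$ parameterized by its mean $x$, i.e. $\Pr(\xi=k)=\dfrac{a_k\,y(x)^k}{w(y(x))}$ for $k=0,1,2,\ldots$, where $y=y(x)\in(0,1)$ is the inverse function of $x=\dfrac{y\,w'(y)}{w(y)}$. Let $v(x)=x(2x+1)(4x+1)$. Then the raw moments $\alpha_m$, the central moments $\mu_m$ and the cumulants $\chi_m$ of $\xi$, regarded as functions of $x>0$, satisfy for all $m=1,2,\ldots$ the recurrence relations $$\alpha_{m+1}=x\,\alpha_m+v(x)\frac{d\alpha_m}{dx},\qquad \alpha_0=1,\ \alpha_1=x,$$ $$\mu_{m+1}=m\,v(x)\,\mu_{m-1}+v(x)\frac{d\mu_m}{dx},\qquad \mu_0=1,\ \mu_1=0,$$ $$\chi_{m+1}=v(x)\frac{d\chi_m}{dx},\qquad \chi_1=x.$$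
   Context: If $w(y)=\sum_{k\ge 0}a_k y^k$ for $0<y<R$ with all $a_k\ge 0$, the power series distribution of $w$ with parameter $y$ is the distribution of the nonnegative-integer-valued random variable $\xi$ with $\Pr(\xi=k)=a_k y^k/w(y)$, $k=0,1,2,\ldots$. Its mean is $E\xi=y w'(y)/w(y)$. Writing $x=E\xi$, the map $y\mapsto x$ is strictly increasing on $(0,R)$ and has an inverse $y=y(x)$; using $x$ instead of $y$ as the parameter is called parameterization by the mean. For $w(y)=(1+\sqrt{1-y})^{-1/2}$ one has $R=1$ and $x$ ranges over $(0,\infty)$. Raw moments: $\alpha_m=E\xi^m$, with generating function $A(z)=E e^{z\xi}=\sum_{m\ge0}\alpha_m z^m/m!$. Central moments: $\mu_m=E(\xi-E\xi)^m$, with generating function $C(z)=e^{-\alpha_1 z}A(z)$. Cumulants: $\chi_m$ is the $m$-th derivative at $z=0$ of $K(z)=\log A(z)$. *)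

(* Defs.v *)
From mathcomp Require Export all_boot all_order all_algebra.
From mathcomp Require Export all_classical all_reals all_analysis.

Set Implicit Arguments.
Unset Strict Implicit.
Unset Printing Implicit Defensive.

Import Order.TTheory GRing.Theory Num.Theory.
Import numFieldNormedType.Exports.

Local Open Scope ring_scope.
Local Open Scope classical_set_scope.


Definition w (R : realType) (y : R) : R := (1 + Num.sqrt (1 - y)) `^ (- 2^-1).

Definition v (R : realType) (x : R) : R := x * (2 * x + 1) * (4 * x + 1).

(* The law is prescribed on the nonnegative integers only: when these masses
   add up to 1, X is almost surely nonnegative-integer-valued. *)
Definition has_power_series_distribution d (T : measurableType d)
    (R : realType) (P : probability T R) (X : {RV P >-> R})
    (g : R -> R) (a : nat -> R) (y : R) : Prop :=
  forall k : nat, pmf X k%:R = a k * y ^+ k / g y.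

(* [fine] sends infinite expectations to 0, so the real-valued quantities below
   are meaningful only together with finiteness of the expectations. *)
Definition raw_moment d (T : measurableType d) (R : realType)
    (P : probability T R) (X : T -> R) (m : nat) : R :=
  fine ('E_P[fun t => (X t ^+ m)%R])%E.

Definition central_moment d (T : measurableType d) (R : realType)
    (P : probability T R) (X : T -> R) (m : nat) : R :=
  fine ('E_P[fun t => ((X t - fine ('E_P[X])%E) ^+ m)%R])%E.

Definition cumulant_gen_fun d (T : measurableType d) (R : realType)
    (P : probability T R) (X : T -> R) (z : R) : R :=
  ln (fine ('M_P X z)).

Definition cumulant d (T : measurableType d) (R : realType)
    (P : probability T R) (X : T -> R) (m : nat) : R :=
  ((cumulant_gen_fun P X)^`(m))%classic 0.

(* Main.v *)
(* All the quantities are polynomials in the mean x. Put g(u) = u w'(u) / w(u).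
   An explicit computation gives u g'(u) = v(g(u)), so the operator u d/du acts on
   functions of the form p(g(u)) as p |-> v p', and on w(u) p(g(u)) as
   p |-> X p + v p'. Termwise differentiation of the power series then gives
   sum_k k^m a_k u^k = w(u) q_m(g(u)) with q_0 = 1 and q_(m+1) = X q_m + v q_m';
   since g(y(x)) = x, the raw moments are alpha_m = q_m(x). The recurrence for the
   central moments follows from it by binomial expansion. The moment generating
   function at z is w(y e^z) / w(y), so the cumulant generating function has
   derivative g(y e^z), and the (m+1)-st cumulant is p_m(x), where p_0 = X and
   p_(m+1) = v p_m'. *)
Require Import Defs.
From mathcomp Require Import all_boot all_order all_algebra.
From mathcomp Require Import all_classical all_reals all_analysis.
From mathcomp Require Import measurable_realfun ring lra.

Set Implicit Arguments.
Unset Strict Implicit.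
Unset Printing Implicit Defensive.

Import Order.TTheory GRing.Theory Num.Theory.
Import numFieldNormedType.Exports.

Local Open Scope ring_scope.
Local Open Scope classical_set_scope.

(** * Termwise differentiation of real power series *)

Section PowerSeries.
Variable R : realType.
Implicit Types (f : nat -> R) (F : R -> R).

(** The gap between [|z|] and an intermediate radius r absorbs the factor k + 1, so the
    differentiated series is dominated by the absolutely convergent one at r. *)
Lemma is_cvg_pseries_diffs_inside f (x z : R) :
  cvgn (pseries f x) -> `|z| < `|x| -> cvgn (pseries (pseries_diffs f) z).
Proof.
move=> Cx zx.
pose r := (`|z| + `|x|) / 2.
have [zr rx] : `|z| < r /\ r < `|x| by rewrite /r; split; lra.
have r0 : 0 < r := le_lt_trans (normr_ge0 z) zr.
(* r^(k+1) - |z|^(k+1) = (r - |z|) * sum_i r^(k-i) |z|^i >= (r - |z|) (k+1) |z|^k *)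
have bound k : k.+1%:R * `|z| ^+ k <= r ^+ k.+1 / (r - `|z|).
  rewrite ler_pdivlMr ?subr_gt0//.
  apply: (@le_trans _ _ (r ^+ k.+1 - `|z| ^+ k.+1)); last first.
    by rewrite lerBlDr lerDl exprn_ge0.
  rewrite subrXX mulrC ler_wpM2l ?subr_ge0 ?(ltW zr)//.
  rewrite mulr_natl.
  have -> : `|z| ^+ k *+ k.+1 = \sum_(i < k.+1) `|z| ^+ k.
    by rewrite sumr_const card_ord.
  apply: ler_sum => i _.
  have ki : (k = (k - i) + i)%N by rewrite subnK// -ltnS.
  rewrite {1}ki exprD ler_wpM2r ?exprn_ge0//.
  by rewrite lerXn2r ?nnegrE// ltW.
apply: normed_cvg.
have Cr : cvgn (pseries (fun i => `|f i|) r).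
  by apply: is_cvg_pseries_inside_norm Cx _; rewrite gtr0_norm.
apply: (@series_le_cvg _ _
    ((r - `|z|)^-1 *: (fun k => `|f k.+1| * r ^+ k.+1))) => [k|k|k|].
- exact: normr_ge0.
- by rewrite /= /GRing.scale/= !mulr_ge0// ?invr_ge0 ?subr_ge0 ?exprn_ge0 1?ltW.
- rewrite /= /pseries_diffs -mulrA !normrM normrX normr_nat mulrCA.
  rewrite [leRHS](_ : _ = `|f k.+1| * (r ^+ k.+1 / (r - `|z|))); last first.
    by rewrite mulrA mulrC.
  by rewrite ler_wpM2l.
- apply: is_cvg_seriesZ.
  (* The dominating terms start at index 1, so their sum is that of the series at r without its term
     of index 0. *)
  move/cvg_ex: Cr => [l Cr].
  apply/cvg_ex; exists (l - `|f 0%N| * r ^+ 0).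
  rewrite (_ : series _ =
      (fun n => pseries (fun i => `|f i|) r n.+1 - `|f 0%N| * r ^+ 0)); last first.
    by apply/funext => n; rewrite /pseries /series/= big_nat_recl//= addrAC subrr add0r.
  by apply: cvgB; [move: Cr; rewrite -cvg_shiftS | exact: cvg_cst].
Qed.

(** The operator u d/du multiplies the k-th coefficient by k and, unlike d/du, leaves exponents
    unshifted, so it can be iterated to produce powers of k. *)
Lemma cvg_pseries_theta f F (rho u : R) :
  (forall t : R, 0 < t < rho -> pseries f t @ \oo --> F t) -> 0 < u < rho ->
  pseries (fun k => k%:R * f k) u @ \oo --> u * (F^`())%classic u.
Proof.
move=> fF /andP[u0 ur].
(* Termwise differentiation requires the series and its first two formal derivatives to converge at
   a common point K beyond u; each formal derivative costs a slightly smaller radius. *)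
pose K1 := (u + rho) / 2; pose K2 := (u + K1) / 2; pose K := (u + K2) / 2.
have [uK [KK2 [K21 K1r]]] : u < K /\ K < K2 /\ K2 < K1 /\ K1 < rho.
  by rewrite /K /K2 /K1; do 3 (split; [lra|]); lra.
have gt0 t : u < t -> `|t| = t by move=> ut; rewrite gtr0_norm// (lt_trans u0).
have u2 : u < K2 := lt_trans uK KK2.
have u1 : u < K1 := lt_trans u2 K21.
have C1 : cvgn (pseries f K1).
  by apply/cvg_ex; exists (F K1); apply: fF; rewrite (lt_trans u0).
have C2 : cvgn (pseries (pseries_diffs f) K2).
  by apply: is_cvg_pseries_diffs_inside C1 _; rewrite !gt0.
have C3 : cvgn (pseries (pseries_diffs (pseries_diffs f)) K).
  by apply: is_cvg_pseries_diffs_inside C2 _; rewrite !gt0.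
have inK (h : nat -> R) t : K < t -> cvgn (pseries h t) -> cvgn (pseries h K).
  move=> Kt /is_cvg_pseries_inside; apply; rewrite !gt0//.
  exact: lt_trans uK Kt.
have uK' : `|u| < `|K| by rewrite (gt0 _ uK) gtr0_norm.
have D := pseries_snd_diffs (inK _ _ (lt_trans KK2 K21) C1) (inK _ _ KK2 C2) C3 uK'.
(* [F] is known to be the sum only on (0, rho), which is a neighbourhood of u. *)
have -> : (F^`())%classic u = limn (pseries (pseries_diffs f) u).
  rewrite derive1E -(@derive_val _ _ _ _ _ _ _ D); apply: near_eq_derive.
  near=> t; apply/esym/cvg_lim => //; apply: fF.
  apply/andP; split; near: t; [exact: lt_nbhsr | exact: lt_nbhsl].
have Cu : cvgn (pseries (pseries_diffs f) u).
  by apply: is_cvg_pseries_inside C2 _; rewrite (gt0 _ u2) gtr0_norm.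
(* The term k = 0 vanishes; after dropping it, a factor u comes out of each remaining term. *)
rewrite -cvg_shiftS.
rewrite (_ : [sequence _]_n = (fun n => u * pseries (pseries_diffs f) u n)).
  by apply: cvgM; [exact: cvg_cst|exact: Cu].
apply/funext => n; rewrite /pseries /series/= big_nat_recl//= !mul0r add0r.
rewrite mulr_sumr; apply: eq_bigr => i _.
by rewrite /pseries_diffs exprS mulrCA.
Unshelve. all: by end_near. Qed.

End PowerSeries.

(** * Expectations under a law carried by the nonnegative integers *)

Section NatValuedExpectation.
Context d (T : measurableType d) (R : realType) (P : probability T R).
Variables (X : {RV P >-> R}) (p : nat -> R).
Hypothesis Xp : forall k : nat, pmf X k%:R = p k.
Hypothesis p1 : series p @ \oo --> (1 : R).

Let A (k : nat) : set T := X @^-1` [set k%:R].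

Let mA k : measurable (A k).
Proof. by rewrite -[A k]setTI; exact: (measurable_funP X). Qed.

Let tA : trivIset setT A.
Proof.
apply/trivIsetP => i j _ _ ij; apply/seteqP; split=> t //= [].
rewrite /A /= => -> /eqP; rewrite eqr_nat => ij'.
by rewrite ij' in ij.
Qed.

Let PA k : P (A k) = (p k)%:E.
Proof. by rewrite -Xp /pmf fineK// fin_num_measure. Qed.

Let nneseries_cvg (u : nat -> R) (l : R) :
  series u @ \oo --> l -> (\sum_(k <oo) (u k)%:E)%E = l%:E.
Proof.
move=> ul; apply/cvg_lim => //.
rewrite (_ : (fun n => _) = EFin \o series u); last first.
  by apply/funext => n /=; rewrite sumEFin.
by apply: cvg_EFin => //; exact: nearW.
Qed.

(** The masses at the integers already add up to 1, so the rest of the space is negligible and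
    integrals reduce to sums over the level sets [A k]. *)
Let PnA : P (~` \bigcup_k A k) = 0%E.
Proof.
rewrite probability_setC; last exact: bigcupT_measurable.
rewrite measure_semi_bigcup//; last exact: bigcupT_measurable.
rewrite (_ : \big[_/_]_(_ <= _ <oo) _ = 1%E); first by rewrite subee.
by rewrite -(nneseries_cvg p1); apply: eq_eseriesr => k _; exact: PA.
Qed.

Let integral_level (g : R -> R) k :
  (\int[P]_(t in A k) (g (X t))%:E = (g k%:R * p k)%:E)%E.
Proof.
rewrite (eq_integral (cst (g k%:R)%:E)); last first.
  by move=> t; rewrite inE /A/= => ->.
by rewrite integral_cst// EFinM; congr (_ * _)%E; exact: PA.
Qed.

Lemma integrable_nat_valued (g : R -> R) : measurable_fun setT g ->
  cvgn (series (fun k => `|g k%:R| * p k)) ->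
  P.-integrable setT (fun t => (g (X t))%:E).
Proof.
move=> mg /cvg_ex[l gl].
have mgX : measurable_fun setT (EFin \o (g \o X)).
  by apply/measurable_EFinP; apply: measurableT_comp.
apply/integrableP; split => //.
rewrite (@ge0_negligible_integral _ _ _ _ setT (~` \bigcup_k A k))//; last 2 first.
- by apply: measurableC; exact: bigcupT_measurable.
- exact: measurableT_comp.
rewrite setTD setCK ge0_integral_bigcup//; last first.
  by apply: measurable_funTS; exact: measurableT_comp.
under eq_eseriesr => k _ do rewrite (integral_level (fun t => `|g t|)).
by rewrite (nneseries_cvg gl) ltry.
Qed.

Lemma expectation_nat_valued (g : R -> R) (l : R) : measurable_fun setT g ->
  cvgn (series (fun k => `|g k%:R| * p k)) ->
  series (fun k => g k%:R * p k) @ \oo --> l ->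
  'E_P[g \o X]%E = l%:E.
Proof.
move=> mg ag gl; have ig := integrable_nat_valued mg ag.
rewrite unlock (@negligible_integral _ _ _ _ setT (~` \bigcup_k A k))//.
- rewrite setTD setCK integral_bigcup//; last first.
    apply: integrableS ig => //; exact: bigcupT_measurable.
  under eq_eseriesr => k _ do rewrite integral_level.
  exact: nneseries_cvg.
- by apply: measurableC; exact: bigcupT_measurable.
Qed.

End NatValuedExpectation.

(** * Binomial transforms and moment polynomials *)

Lemma binomial_transformS (K : comNzRingType) (c : K) (q : nat -> K) (m : nat) :
  \sum_(i < m.+2) (c ^+ (m.+1 - i) * q i) *+ 'C(m.+1, i) =
  \sum_(i < m.+1) (c ^+ (m - i) * (q i.+1 + c * q i)) *+ 'C(m, i).
Proof.
pose F i := (c ^+ (m.+1 - i) * q i) *+ 'C(m, i).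
(* [F m.+1] vanishes with its binomial coefficient. This realigns the indices of the two sums that
   Pascal's rule creates below. *)
have FE : \sum_(i < m.+1) F i = F 0%N + \sum_(i < m.+1) F i.+1.
  have := @big_ord_recl _ 0 +%R m.+1 (fun i : 'I_m.+2 => F i).
  by rewrite big_ord_recr /= [F m.+1]/F bin_small// mulr0n addr0.
rewrite big_ord_recl /= !bin0 subn0.
under eq_bigr => i _ do rewrite binS subSS mulrnDr.
rewrite big_split /= addrA.
transitivity (\sum_(i < m.+1) F i +
    \sum_(i < m.+1) (c ^+ (m - i) * q i.+1) *+ 'C(m, i)).
  by rewrite FE /F !bin0 subn0; under [in RHS]eq_bigr => i _ do rewrite subSS.
rewrite addrC -big_split /=; apply: eq_bigr => i _.
by rewrite /F -mulrnDl mulrDr mulrA -exprSr subSn// -ltnS.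
Qed.

Section MomentPolynomials.
Variables (K : comNzRingType) (V : {poly K}).

Fixpoint raw_poly (m : nat) : {poly K} :=
  if m is m'.+1 then 'X * raw_poly m' + V * (raw_poly m')^`() else 1.

(* Indexed from 0: [cumulant_poly m] gives the cumulant of order m + 1. *)
Definition cumulant_poly (m : nat) : {poly K} := iter m (fun p => V * p^`()) 'X.

(** The binomial expansion of the central moment with the mean itself as the variable, so that
    differentiation also acts on the centring. *)
Definition central_poly (m : nat) : {poly K} :=
  \sum_(i < m.+1) ((- 'X) ^+ (m - i) * raw_poly i) *+ 'C(m, i).

(** By the Leibniz rule, differentiating the powers of [- 'X] gives [- s1], which cancels the term
    in [central_poly m.-1]; differentiating the raw polynomials gives [s2], the binomial transform
    of order m + 1. *)
Lemma central_polyS m :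
  central_poly m.+1 =
  (m%:R * V) * central_poly m.-1 + V * (central_poly m)^`().
Proof.
rewrite /central_poly raddf_sum /=.
pose s1 := \sum_(i < m.+1)
  (V * ((- 'X) ^+ (m - i.+1) * raw_poly i)) *+ ((m - i) * 'C(m, i)).
pose s2 := \sum_(i < m.+1)
  ((- 'X) ^+ (m - i) * (raw_poly i.+1 - 'X * raw_poly i)) *+ 'C(m, i).
have -> : V * (\sum_(i < m.+1)
    (((- 'X) ^+ (m - i) * raw_poly i) *+ 'C(m, i))^`()) = s2 - s1.
  rewrite mulr_sumr -sumrB; apply: eq_bigr => i _.
  rewrite mulrnA -mulrnBl derivMn mulrnAr; congr (_ *+ _).
  rewrite derivM deriv_exp derivN derivX -subnS /=.
  rewrite ['X * _ + _]addrC addrK mulN1r mulrDr addrC; congr (_ + _).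
    by rewrite mulrCA.
  by rewrite mulNrn mulNr mulrN mulrnAl mulrnAr.
have -> : (m%:R * V) * (\sum_(i < m.-1.+1)
    ((- 'X) ^+ (m.-1 - i) * raw_poly i) *+ 'C(m.-1, i)) = s1.
  (* At m = 0 the truncated [m.-1] is harmless: the factors m and m - i both vanish. For n = m + 1,
     the identity (n - i) C(n, i) = n C(n - 1, i) matches the sums term by term. *)
  case: m @s1 @s2 => [|m] s1 s2.
    by rewrite mul0r mul0r /s1 big_ord1 !sub0n mul0n.
  rewrite /s1 [RHS]big_ord_recr/= subnn mul0n mulr0n addr0 mulr_sumr.
  apply: eq_bigr => i _.
  by rewrite -mul_bin_down mulnC mulrnA subSS mulrnAr -mulrA mulr_natl mulrnAC.
rewrite addrC subrK /s2 binomial_transformS.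
by under eq_bigr => i _ do rewrite mulNr.
Qed.

End MomentPolynomials.

(** * The function [w] and its mean in closed form *)

Section TheWeight.
Variable R : realType.
Implicit Types (u c : R) (m : nat).

(* The mean u w'(u) / w(u) in closed form; with s = sqrt(1 - u) it is
   (1 - s) / (4 s), and v at this point is (1 - s^2) / (8 s^3). *)
Definition tilted_mean (u : R) : R :=
  4^-1 * ((Num.sqrt (1 - u))^-1 - 1).

Definition v_poly : {poly R} := 'X * (2 *: 'X + 1) * (4 *: 'X + 1).

Lemma horner_v_poly x : v_poly.[x] = v x.
Proof. by rewrite /v_poly /v !hornerE. Qed.

Lemma w_gt0 u : 0 < w u.
Proof. by rewrite powR_gt0// ltr_wpDr// sqrtr_ge0. Qed.

Lemma is_derive_sqrt1B u : u < 1 ->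
  is_derive u 1 (fun t : R => Num.sqrt (1 - t)) (- (2 * Num.sqrt (1 - u))^-1).
Proof.
move=> u1.
have D1 : is_derive u 1 (fun t : R => 1 - t) (-1).
  by rewrite -[-1]sub0r; exact: (@is_deriveB R R R (cst 1) id).
have D2 : is_derive (1 - u) 1 Num.sqrt (2 * Num.sqrt (1 - u))^-1.
  by apply: is_derive1_sqrt; rewrite subr_gt0.
by have := @is_derive1_comp _ _ (fun t : R => 1 - t) _ _ _ D2 D1; rewrite mulrN1.
Qed.

Lemma is_derive_w u : 0 < u < 1 -> is_derive u 1 (@w R) (w u * tilted_mean u / u).
Proof.
move=> /andP[u0 u1].
have s0 : 0 < Num.sqrt (1 - u) by rewrite sqrtr_gt0 subr_gt0.
have D1 : is_derive u 1 (fun t : R => 1 + Num.sqrt (1 - t))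
    (- (2 * Num.sqrt (1 - u))^-1).
  rewrite -[X in is_derive _ _ _ X]add0r.
  exact: (@is_deriveD R R R (cst 1) _ _ _ _ _ _ (is_derive_sqrt1B u1)).
have s1 : 0 < 1 + Num.sqrt (1 - u) by rewrite addr_gt0.
have D2 := is_derive1_powR (- 2^-1) s1.
have := @is_derive1_comp _ _ (fun t : R => 1 + Num.sqrt (1 - t)) _ _ _ D2 D1.
move=> D; apply: (@is_derive_eq _ _ _ _ _ _ _ _ D).
rewrite powRB; last by rewrite (gt_eqF s1) implybT.
rewrite powRr1 1?ltW// -/(w u) /tilted_mean.
(* Substituting u = 1 - s^2 with s = sqrt(1 - u) leaves a rational identity in s. *)
have uE : 1 - Num.sqrt (1 - u) ^+ 2 = u.
  by rewrite sqr_sqrtr ?subr_ge0 1?ltW//; ring.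
move: (w u) uE s0 s1 => W; set s := Num.sqrt _ => uE s0 s1.
rewrite -uE in u0 *; clear -s0 s1 u0.
by field; rewrite !gt_eqF.
Qed.

Lemma is_derive_tilted_mean u : 0 < u < 1 ->
  is_derive u 1 tilted_mean (v (tilted_mean u) / u).
Proof.
move=> /andP[u0 u1].
have s0 : 0 < Num.sqrt (1 - u) by rewrite sqrtr_gt0 subr_gt0.
have D1 := @is_deriveV _ (fun t : R => Num.sqrt (1 - t)) _ _ _ (lt0r_neq0 s0) (is_derive_sqrt1B u1).
have D2 := is_deriveZ (4^-1 : R) (is_deriveB D1 (is_derive_cst (1 : R) u 1)).
apply: (@is_derive_eq _ _ _ _ _ _ _ _ D2).
rewrite subr0 /GRing.scale/= /v /tilted_mean.
have uE : 1 - Num.sqrt (1 - u) ^+ 2 = u.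
  by rewrite sqr_sqrtr ?subr_ge0 1?ltW//; ring.
move: uE s0; set s := Num.sqrt _ => uE s0.
rewrite -uE in u0 *; clear -s0 u0.
by field; rewrite !gt_eqF.
Qed.

Lemma is_derive_horner_tilted_mean (p : {poly R}) u : 0 < u < 1 ->
  is_derive u 1 (fun t => p.[tilted_mean t]) ((v_poly * p^`()).[tilted_mean u] / u).
Proof.
move=> u01.
have := @is_derive1_comp _ _ tilted_mean _ _ _ (is_derive_poly p _) (is_derive_tilted_mean u01).
by rewrite hornerM horner_v_poly mulrCA mulrA.
Qed.

(** * Moment series of the coefficients of [w] *)

Section Coefficients.
Variable a : nat -> R.
Hypothesis a_w : forall u, 0 < u < 1 -> pseries a u @ \oo --> w u.

Lemma cvg_raw_moment_series m u : 0 < u < 1 ->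
  pseries (fun k => k%:R ^+ m * a k) u @ \oo -->
    w u * (raw_poly v_poly m).[tilted_mean u].
Proof.
elim: m u => [|m IH] u u01.
  rewrite hornerE mulr1 (_ : (fun k => _) = a); first exact: a_w.
  by apply/funext => k; rewrite expr0 mul1r.
have D : is_derive u 1 (fun t => w t * (raw_poly v_poly m).[tilted_mean t]) _ :=
  is_deriveM (is_derive_w u01)
    (is_derive_horner_tilted_mean (raw_poly v_poly m) u01).
have := cvg_pseries_theta IH u01.
rewrite derive1E (@derive_val _ _ _ _ _ _ _ D).
under [fun k => k%:R * _]funext => k do rewrite mulrA -exprS.
congr (_ --> _); rewrite /GRing.scale /= hornerD !hornerM hornerX.
have u0 : u != 0 by case/andP: u01 => /gt_eqF ->.
by field.
Qed.

(** A finite combination of the raw series. The centre [c] stays free: 0 serves the raw moments, the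
    mean serves the central ones. *)
Lemma cvg_central_moment_series c m u : 0 < u < 1 ->
  pseries (fun k => (k%:R - c) ^+ m * a k) u @ \oo -->
    w u * \sum_(i < m.+1)
      ((- c) ^+ (m - i) * (raw_poly v_poly i).[tilted_mean u]) *+ 'C(m, i).
Proof.
move=> u01; rewrite mulr_sumr.
rewrite (_ : pseries _ u = \sum_(i < m.+1)
    (fun n => (- c) ^+ (m - i) *+ 'C(m, i) *
      pseries (fun k => k%:R ^+ i * a k) u n)).
  apply: (big_ind2 (fun (s : nat -> R) (l : R) => s @ \oo --> l))
    => [|s1 l1 s2 l2|i _].
  - exact: cvg_cst.
  - exact: cvgD.
  rewrite -mulrnAl mulrCA.
  by apply: cvgM; [exact: cvg_cst | exact: cvg_raw_moment_series].
apply/funext => n; rewrite fct_sumE /pseries /series /=.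
under [RHS]eq_bigr => i _ do rewrite mulr_sumr.
rewrite exchange_big /=; apply: eq_bigr => k _.
rewrite addrC exprDn !mulr_suml; apply: eq_bigr => i _.
by rewrite !mulrnAl !mulrA.
Qed.

(** Convergence at the midpoint of u and 1 forces absolute convergence at u. *)
Lemma is_cvg_central_moment_series_norm c m u : 0 < u < 1 ->
  cvgn (pseries (fun k => `|(k%:R - c) ^+ m * a k|) u).
Proof.
move=> /andP[u0 u1].
have C : cvgn (pseries (fun k => (k%:R - c) ^+ m * a k) ((u + 1) / 2)).
  by apply/cvg_ex; eexists; apply: cvg_central_moment_series; lra.
by apply: is_cvg_pseries_inside_norm C _; rewrite !gtr0_norm//; lra.
Qed.

End Coefficients.
End TheWeight.

(** * Moments and cumulants of the law at a fixed parameter u *)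

Section TheLaw.
Variables (R : realType) (a : nat -> R).
Hypothesis a_w : forall u : R, 0 < u < 1 -> pseries a u @ \oo --> w u.
Context d (T : measurableType d) (P : probability T R).
Variables (X : {RV P >-> R}) (u : R).
Hypotheses (u01 : 0 < u < 1)
  (Xu : has_power_series_distribution X (@w R) a u).

Implicit Types (c z : R) (m : nat).

Let p k := a k * u ^+ k / w u.

Let cvg_masses (h : nat -> R) l : pseries (fun k => h k * a k) u @ \oo --> w u * l ->
  series (fun k => h k * p k) @ \oo --> l.
Proof.
move=> hl.
have -> : series (fun k => h k * p k) =
    (fun n => (w u)^-1 * pseries (fun k => h k * a k) u n).
  apply/funext => n; rewrite /pseries /series /= mulr_sumr.
  by apply: eq_bigr => k _; rewrite /p !mulrA mulrC !mulrA.
rewrite -[l](mulKf (lt0r_neq0 (w_gt0 u))).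
by apply: cvgM => //; exact: cvg_cst.
Qed.

Let p1 : series p @ \oo --> (1 : R).
Proof.
rewrite (_ : p = (fun k => 1 * p k)); last by apply/funext => k; rewrite mul1r.
apply: cvg_masses; rewrite mulr1.
by under [fun k => 1 * _]funext => k do rewrite mul1r; exact: a_w.
Qed.

Let p_ge0 k : 0 <= p k.
Proof. by rewrite /p -Xu pmf_ge0. Qed.

(** Read off the law: a k u^k / w u is a probability, while u and w u are positive. *)
Let a_ge0 k : 0 <= a k.
Proof.
case/andP: u01 => u0 _; have := p_ge0 k.
by rewrite /p pmulr_lge0 ?invr_gt0 ?w_gt0// pmulr_lge0 ?exprn_gt0.
Qed.

Let is_cvg_central_masses_norm c m :
  cvgn (series (fun k => `|(k%:R - c) ^+ m| * p k)).
Proof.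
have /cvg_ex[l hl] := @is_cvg_central_moment_series_norm _ _ a_w c m _ u01.
apply/cvg_ex; exists (l / w u); apply: cvg_masses.
rewrite mulrC divfK ?lt0r_neq0 ?w_gt0//.
rewrite (_ : (fun k => _) = (fun k => `|(k%:R - c) ^+ m * a k|))//.
by apply/funext => k; rewrite normrM (ger0_norm (a_ge0 k)).
Qed.

Let measurable_power c m : measurable_fun [set: R] (fun t : R => (t - c) ^+ m).
Proof. by apply: measurable_funX; apply: measurable_funB. Qed.

Lemma integrable_central_power c m :
  P.-integrable setT (fun t => ((X t - c) ^+ m)%:E).
Proof.
exact: (integrable_nat_valued Xu p1 (@measurable_power c m)
  (@is_cvg_central_masses_norm c m)).
Qed.

Lemma expectation_central_power c m : ('E_P[fun t => ((X t - c) ^+ m)%R] =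
  (\sum_(i < m.+1)
    ((- c) ^+ (m - i) * (raw_poly (v_poly R) i).[tilted_mean u]) *+ 'C(m, i))%:E)%E.
Proof.
apply: (expectation_nat_valued Xu p1 (@measurable_power c m)
  (@is_cvg_central_masses_norm c m)).
by apply: cvg_masses; exact: cvg_central_moment_series.
Qed.

Lemma raw_momentE m : raw_moment P X m = (raw_poly (v_poly R) m).[tilted_mean u].
Proof.
rewrite /raw_moment (_ : (fun t => _) = (fun t => (X t - 0) ^+ m)); last first.
  by apply/funext => t; rewrite subr0.
(* With centre 0 only the summand i = m survives; the others carry a positive power of 0. *)
rewrite expectation_central_power /= big_ord_recr /= binn subnn mul1r.
rewrite big1 ?add0r// => i _.
by rewrite oppr0 expr0n subn_eq0 leqNgt ltn_ord mul0r mul0rn.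
Qed.

Lemma mean_tilted : fine 'E_P[X]%E = tilted_mean u.
Proof.
rewrite (_ : (X : T -> R) = (fun t => X t ^+ 1)); last first.
  by apply/funext => t; rewrite expr1.
have := raw_momentE 1; rewrite /raw_moment => ->.
by rewrite /= derivC mulr0 addr0 mulr1 hornerX.
Qed.

Lemma central_momentE m :
  central_moment P X m = (central_poly (v_poly R) m).[tilted_mean u].
Proof.
rewrite /central_moment mean_tilted expectation_central_power /=.
rewrite horner_sum; apply: eq_bigr => i _.
by rewrite hornerMn hornerM horner_exp hornerN hornerX.
Qed.

(** The tilted parameter u e^z must stay where the series of [w] is known to converge. *)
Let u_expR z : z < - ln u -> 0 < u * expR z < 1.
Proof.
case/andP: u01 => u0 _ zu; rewrite mulr_gt0 ?expR_gt0//=.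
rewrite mulrC -ltr_pdivlMr// div1r -[u^-1]lnK ?posrE ?invr_gt0//.
by rewrite ltr_expR lnV.
Qed.

Lemma mmt_gen_funE z : z < - ln u -> 'M_P X z = (w (u * expR z) / w u)%:E.
Proof.
move=> zu.
have H : series (fun k => expR (k%:R * z) * p k) @ \oo --> w (u * expR z) / w u.
  apply: cvg_masses; rewrite mulrC divfK ?lt0r_neq0 ?w_gt0//.
  rewrite (_ : pseries _ u = pseries a (u * expR z)).
    by apply: a_w; exact: u_expR.
  apply/funext => n; apply: eq_bigr => k _ /=.
  by rewrite exprMn -expRM_natl -mulrA mulrC mulrA.
rewrite /mmt_gen_fun.
apply: (@expectation_nat_valued _ _ _ _ _ _ Xu p1 (fun t => expR (t * z))) => //.
  by apply: measurableT_comp => //; exact: measurable_funM.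
(* The exponentials are positive, so absolute convergence is [H] itself. *)
apply/cvg_ex; exists (w (u * expR z) / w u).
by under [fun k => _ * p k]funext => k do rewrite (ger0_norm (expR_ge0 _)).
Qed.

Lemma cumulant_gen_funE z : z < - ln u ->
  cumulant_gen_fun P X z = ln (w (u * expR z) / w u).
Proof. by move=> zu; rewrite /cumulant_gen_fun mmt_gen_funE. Qed.

Let is_derive_uexp z : is_derive z 1 (fun t : R => u * expR t) (u * expR z).
Proof. exact: (@is_deriveZ _ _ _ expR u z 1 _ (is_derive_expR z)). Qed.

Lemma is_derive_cumulant_gen_fun z : z < - ln u ->
  is_derive z 1 (cumulant_gen_fun P X) (tilted_mean (u * expR z)).
Proof.
move=> zu; have uz := u_expR zu.
have w0 := lt0r_neq0 (w_gt0 u); have wz0 := lt0r_neq0 (w_gt0 (u * expR z)).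
have D1 := @is_derive1_comp _ _ (fun t => u * expR t) _ _ _
  (is_derive_w uz) (is_derive_uexp z).
have D2 := is_deriveZ (w u)^-1 D1.
have L : 0 < (w u)^-1 * w (u * expR z) by rewrite mulr_gt0 ?invr_gt0 ?w_gt0.
have D3 := @is_derive1_comp _ _ (fun t => (w u)^-1 * w (u * expR t)) _ _ _
  (is_derive1_ln L) D2.
have D4 : is_derive z 1 (fun t => ln ((w u)^-1 * w (u * expR t)))
    (tilted_mean (u * expR z)).
  apply: (@is_derive_eq _ _ _ _ _ _ _ _ D3); rewrite /GRing.scale /=.
  have uz0 : u * expR z != 0 by case/andP: uz => /lt0r_neq0.
  move: (w u) (w _) (tilted_mean _) w0 wz0 => W Wz g W0 Wz0.
  rewrite divfK//.
  by field; rewrite W0.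
(* The closed form holds for t < - ln u, an open condition, hence near z. *)
apply: near_eq_is_derive D4; near=> t.
by rewrite cumulant_gen_funE 1?mulrC//; near: t; exact: lt_nbhsl.
Unshelve. all: by end_near. Qed.

(** Stated on the whole half-line, since the induction step differentiates the formula near z. Index
    m describes the derivative of the m-th derivative, hence order m + 1. *)
Lemma is_derive_cumulant_gen_funn m z : z < - ln u ->
  is_derive z 1 ((cumulant_gen_fun P X)^`(m))%classic
    (cumulant_poly (v_poly R) m).[tilted_mean (u * expR z)].
Proof.
elim: m z => [|m IH] z zu.
  by rewrite derive1n0 /cumulant_poly /= hornerX; exact: is_derive_cumulant_gen_fun.
have uz := u_expR zu.
have D := @is_derive1_comp _ _ (fun t => u * expR t) _ _ _
  (is_derive_horner_tilted_mean (cumulant_poly (v_poly R) m) uz) (is_derive_uexp z).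
have {}D : is_derive z 1
    (fun t => (cumulant_poly (v_poly R) m).[tilted_mean (u * expR t)])
    (cumulant_poly (v_poly R) m.+1).[tilted_mean (u * expR z)].
  apply: (@is_derive_eq _ _ _ _ _ _ _ _ D).
  by rewrite divfK//; case/andP: uz => /lt0r_neq0.
rewrite derive1nS; apply: near_eq_is_derive D; near=> t.
rewrite derive1E (@derive_val _ _ _ _ _ _ _ (IH t _))//.
by near: t; exact: lt_nbhsl.
Unshelve. all: by end_near. Qed.

(** Places 0, where the cumulants are evaluated, inside the half-line z < - ln u. *)
Lemma oppr_ln_gt0 : 0 < - ln u.
Proof. by rewrite oppr_gt0 ln_lt0. Qed.

Lemma cumulantE m :
  cumulant P X m.+1 = (cumulant_poly (v_poly R) m).[tilted_mean u].
Proof.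
rewrite /cumulant derive1nS derive1E.
rewrite (@derive_val _ _ _ _ _ _ _ (is_derive_cumulant_gen_funn m oppr_ln_gt0)).
by rewrite expR0 mulr1.
Qed.

End TheLaw.

(** * Recurrences in the mean parameter *)

Lemma is_derive_near_poly (R : realType) (f : R -> R) (p : {poly R}) (x : R) :
  0 < x -> (forall t, 0 < t -> f t = p.[t]) -> is_derive x 1 f p^`().[x].
Proof.
move=> x0 fp; apply: near_eq_is_derive (is_derive_poly p x).
near=> t; rewrite fp//; near: t; exact: lt_nbhsr.
Unshelve. all: by end_near. Qed.

Theorem theorem1 (R : realType)
  (a : nat -> R)
  (a_w : forall u : R, 0 < u < 1 -> pseries a u @ \oo --> w u)
  (y : R -> R)
  (y01 : forall x : R, 0 < x -> 0 < y x < 1)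
  (y_inv : forall x : R, 0 < x -> y x * ((@w R)^`())%classic (y x) / w (y x) = x)
  (d : R -> measure_display) (T : forall x : R, measurableType (d x))
  (P : forall x : R, probability (T x) R)
  (xi : forall x : R, {RV (P x) >-> R})
  (xi_psd : forall x : R, 0 < x ->
     has_power_series_distribution (xi x) (@w R) a (y x)) :
  let alpha (m : nat) (x : R) := raw_moment (P x) (xi x) m in
  let mu (m : nat) (x : R) := central_moment (P x) (xi x) m in
  let chi (m : nat) (x : R) := cumulant (P x) (xi x) m in
  forall x : R, 0 < x ->
  (* the moments and the cumulants exist *)
  [/\ forall m : nat, (P x).-integrable setT
        (fun t => ((xi x : T x -> R) t ^+ m)%:E),
      \forall z \near (0 : R), 'M_(P x) (xi x) z \is a fin_num
    & forall m : nat,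
        derivable ((cumulant_gen_fun (P x) (xi x))^`(m))%classic (0 : R) 1] /\
  [/\ alpha 0%N x = 1, alpha 1%N x = x &
      forall m : nat, (1 <= m)%N ->
        derivable (alpha m) x 1 /\
        alpha m.+1 x = x * alpha m x + v x * ((alpha m)^`())%classic x] /\
  [/\ mu 0%N x = 1, mu 1%N x = 0 &
      forall m : nat, (1 <= m)%N ->
        derivable (mu m) x 1 /\
        mu m.+1 x = m%:R * v x * mu m.-1 x + v x * ((mu m)^`())%classic x] /\
  (chi 1%N x = x /\
      forall m : nat, (1 <= m)%N ->
        derivable (chi m) x 1 /\
        chi m.+1 x = v x * ((chi m)^`())%classic x).
Proof.
move=> alpha mu chi.
(* The inversion hypothesis, once w' is computed, says that the closed-form mean at [y x] is x. *)
have mean x : 0 < x -> tilted_mean (y x) = x.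
  move=> x0; rewrite -[RHS](y_inv _ x0) derive1E.
  rewrite (@derive_val _ _ _ _ _ _ _ (is_derive_w (y01 _ x0))).
  have /andP[/lt0r_neq0 yx0 _] := y01 _ x0.
  by field; rewrite yx0 lt0r_neq0 ?w_gt0.
(* As these identities hold for all x > 0, derivatives in x are those of polynomials, and [y] is
   never differentiated. *)
have alphaE m x : 0 < x -> alpha m x = (raw_poly (v_poly R) m).[x].
  move=> x0; rewrite -[in RHS](mean _ x0).
  exact: (raw_momentE a_w (y01 _ x0) (xi_psd _ x0) m).
have muE m x : 0 < x -> mu m x = (central_poly (v_poly R) m).[x].
  move=> x0; rewrite -[in RHS](mean _ x0).
  exact: (central_momentE a_w (y01 _ x0) (xi_psd _ x0) m).
have chiE m x : 0 < x -> chi m.+1 x = (cumulant_poly (v_poly R) m).[x].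
  move=> x0; rewrite -[in RHS](mean _ x0).
  exact: (cumulantE a_w (y01 _ x0) (xi_psd _ x0) m).
have val f l (x : R) : is_derive x 1 f l -> (f^`())%classic x = l :> R.
  by move=> D; rewrite derive1E (@derive_val _ _ _ _ _ _ _ D).
move=> x x0; split; [|split; [|split]].
- split=> [m||m].
  + have := integrable_central_power a_w (y01 _ x0) (xi_psd _ x0) 0 m.
    by under [fun t => ((_ - 0) ^+ m)%:E]funext => t do rewrite subr0.
  + near=> z; rewrite (mmt_gen_funE a_w (y01 _ x0) (xi_psd _ x0))//.
    by near: z; apply: lt_nbhsl; exact: (oppr_ln_gt0 (y01 _ x0)).
  + have D := is_derive_cumulant_gen_funn a_w (y01 _ x0) (xi_psd _ x0) m
      (oppr_ln_gt0 (y01 _ x0)).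
    exact: (@ex_derive _ _ _ _ _ _ _ D).
- split=> [||m _].
  + by rewrite alphaE// hornerE.
  + by rewrite alphaE//= derivC mulr0 addr0 mulr1 hornerX.
  + have D := is_derive_near_poly x0 (fun t => @alphaE m t).
    split; first exact: (@ex_derive _ _ _ _ _ _ _ D).
    by rewrite (val _ _ _ D) !alphaE//= -horner_v_poly hornerD !hornerM hornerX.
- split=> [||m _].
  + by rewrite muE// /central_poly big_ord1 /= mul1r hornerE.
  (* The recurrence at m = 0: its first term has factor 0 and its second differentiates a
     constant. *)
  + rewrite muE// central_polyS !mul0r add0r /central_poly big_ord1 /= mul1r.
    by rewrite derivC mulr0 horner0.
  + have D := is_derive_near_poly x0 (fun t => @muE m t).
    split; first exact: (@ex_derive _ _ _ _ _ _ _ D).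
    rewrite (val _ _ _ D) !muE// central_polyS -horner_v_poly.
    by rewrite hornerD !hornerM -polyC_natr hornerC.
- split=> [|[//|m] _]; first by rewrite chiE// hornerX.
  have D := is_derive_near_poly x0 (fun t => @chiE m t).
  split; first exact: (@ex_derive _ _ _ _ _ _ _ D).
  by rewrite (val _ _ _ D) chiE// -horner_v_poly -hornerM.
Unshelve. all: by end_near. Qed.
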